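(* Let $\mathcal{E}_{t,\mu}=\{p_\theta:\theta\in\Theta\}$ be a conic exponential family with log-partition function $F$. Let $k,k'\ge 1$, let $\theta_1,\dots,\theta_k,\theta'_1,\dots,\theta'_{k'}\in\Theta$, let $w\in\mathbb{R}_+^k$ and $w'\in\mathbb{R}_+^{k'}$ satisfy $\sum_{i=1}^k w_i=1=\sum_{j=1}^{k'}w'_j$, and let $m=\sum_{i=1}^k w_i p_{\theta_i}$ and $m'=\sum_{j=1}^{k'} w'_j p_{\theta'_j}$. Then: (i) for every integer $\alpha\ge 2$, the Minkowski difference distance $D_\alpha(m,m')$ and the Minkowski log-ratio distance $L_\alpha(m,m')$ admit closed-form formulas; (ii) for every even integer $\alpha\ge 2$, the statistical Minkowski distance $M_\alpha(m,m')$ admits a closed-form formula.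
   Context: Setting: $(\mathcal{X},\mathcal{F})$ is a measurable space with a nonzero positive measure $\mu$. For measurable $f:\mathcal{X}\to\mathbb{R}$ and $\alpha\ge 1$, $\|f\|_\alpha=\left(\int_{\mathcal{X}}|f|^\alpha\,\mathrm{d}\mu\right)^{1/\alpha}$ is the norm of $L_\alpha(\mu)$. Exponential family: given a measurable map $t:\mathcal{X}\to\mathbb{R}^D$ (sufficient statistics), the natural parameter space is $\Theta=\{\theta\in\mathbb{R}^D:\int_{\mathcal{X}}\exp(t(x)^\top\theta)\,\mathrm{d}\mu(x)<\infty\}$, the log-partition function is $F(\theta)=\log\int_{\mathcal{X}}\exp(t(x)^\top\theta)\,\mathrm{d}\mu(x)$ for $\theta\in\Theta$, and $\mathcal{E}_{t,\mu}=\{p_\theta:\theta\in\Theta\}$ with $p_\theta(x)=\exp(t(x)^\top\theta-F(\theta))$. It is called a conic exponential family (CEF) if $\Theta$ is a cone, i.e. $\lambda\theta\in\Theta$ for all $\theta\in\Theta$ and $\lambda>0$. Distances between probability densities $p,q\in L_\alpha(\mu)$: $M_\alpha(p,q)=\|p-q\|_\alpha$; $D_\alpha(p,q)=\|p\|_\alpha+\|q\|_\alpha-\|p+q\|_\alpha$ (for $\alpha>1$); $L_\alpha(p,q)=-\log\frac{\|p+q\|_\alpha}{\|p\|_\alpha+\|q\|_\alpha}$ (for $\alpha>1$). Meaning of closed form: write $N=k+k'$, $(v_1,\dots,v_N)=(w_1,\dots,w_k,w'_1,\dots,w'_{k'})$ and $(\eta_1,\dots,\eta_N)=(\theta_1,\dots,\theta_k,\theta'_1,\dots,\theta'_{k'})$.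 A basic sum is an expression $$\sum_{a\in\mathbb{N}^N,\ a_1+\dots+a_N=\alpha} c_a\left(\prod_{i=1}^N v_i^{a_i}\right)\exp\left(F\Big(\sum_{i=1}^N a_i\eta_i\Big)-\sum_{i=1}^N a_iF(\eta_i)\right)$$ where $\mathbb{N}=\{0,1,2,\dots\}$, $0^0=1$, and the $c_a$ are explicit integers depending only on $\alpha,k,k',a$. A quantity admits a closed-form formula if it is finite and is given by an explicit finite expression, of a shape depending only on $\alpha,k,k'$, built from basic sums by additions, subtractions, divisions, $\alpha$-th roots and logarithms. *)

(* Defs.v *)
(* MathComp / MathComp-Analysis, over an arbitrary R : realType *)
From HB Require Import structures.
From mathcomp Require Import all_boot all_order all_algebra.
From mathcomp Require Import all_classical all_reals all_analysis.

Set Implicit Arguments.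
Unset Strict Implicit.
Unset Printing Implicit Defensive.

Import Order.TTheory GRing.Theory Num.Theory.

Local Open Scope classical_set_scope.
Local Open Scope ring_scope.

Section exponential_family.
Context {d : measure_display} {X : measurableType d} {R : realType}.
Variables (mu : {measure set X -> \bar R}) (D : nat) (t : X -> D.-tuple R).
Implicit Types theta : 'rV[R]_D.

Definition stat_dot theta (x : X) : R := \sum_(i < D) tnth (t x) i * theta 0 i.

Definition partition_function theta : \bar R :=
  (\int[mu]_x (expR (stat_dot theta x))%:E)%E.

Definition natural_space : set 'rV[R]_D :=
  [set theta | (partition_function theta < +oo)%E].

(* meaningful only for theta in natural_space *)
Definition log_partition theta : R := ln (fine (partition_function theta)).

Definition expfam_density theta (x : X) : R :=
  expR (stat_dot theta x - log_partition theta).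

Definition conic_expfam : Prop :=
  forall theta (lambda : R), natural_space theta -> 0 < lambda ->
    natural_space (lambda *: theta).

Definition mixture k (w : 'I_k -> R) (theta : 'I_k -> 'rV[R]_D) (x : X) : R :=
  \sum_(i < k) w i * expfam_density (theta i) x.

End exponential_family.

(* The distances take values in \bar R.  With the library's conventions
   (+oo - +oo = -oo, +oo^-1 = 0, lne 0 = -oo), each of the last two is infinite
   whenever one of the norms occurring in it is +oo. *)
Section minkowski_distances.
Context {d : measure_display} {X : measurableType d} {R : realType}.
Variables (mu : {measure set X -> \bar R}) (alpha : R).
Implicit Types p q : X -> R.
Local Open Scope ereal_scope.

Definition Lalpha_norm p : \bar R := 'N[mu]_(alpha%:E)[EFin \o p].

Definition minkowski_dist p q : \bar R := Lalpha_norm (p \- q)%R.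

Definition minkowski_diff_dist p q : \bar R :=
  Lalpha_norm p + Lalpha_norm q - Lalpha_norm (p \+ q)%R.

Definition minkowski_logratio_dist p q : \bar R :=
  - lne (Lalpha_norm (p \+ q)%R / (Lalpha_norm p + Lalpha_norm q)).

End minkowski_distances.

Definition ord_cat T m n (f : 'I_m -> T) (g : 'I_n -> T) (i : 'I_(m + n)) : T :=
  match fintype.split i with inl j => f j | inr j => g j end.

(* Finite expressions built from basic sums.  A multi-index a in N^N of weight
   alpha has all entries at most alpha, hence its encoding as a finite function
   'I_N -> 'I_alpha.+1; the values of the coefficient function at functions of
   another weight are never used.  The syntax mentions neither the scalars nor
   the measure space, the family or the parameters. *)
Inductive cf_expr (alpha N : nat) : Type :=
| BasicSum of ({ffun 'I_N -> 'I_alpha.+1} -> int)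
| CfAdd of cf_expr alpha N & cf_expr alpha N
| CfSub of cf_expr alpha N & cf_expr alpha N
| CfDiv of cf_expr alpha N & cf_expr alpha N
| CfRoot of cf_expr alpha N
| CfLog of cf_expr alpha N.

Section closed_form.
Context {R : realType} {D : nat}.
Variables (Theta : set 'rV[R]_D) (F : 'rV[R]_D -> R).
Context {alpha N : nat}.
Variables (v : 'I_N -> R) (eta : 'I_N -> 'rV[R]_D).

Definition basic_sum (c : {ffun 'I_N -> 'I_alpha.+1} -> int) : R :=
  \sum_(a : {ffun 'I_N -> 'I_alpha.+1} | (\sum_i a i)%N == alpha)
    (c a)%:~R * (\prod_i v i ^+ a i)
    * expR (F (\sum_i (a i)%:R *: eta i) - \sum_i (a i)%:R * F (eta i)).

Fixpoint cf_value (e : cf_expr alpha N) : R :=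
  match e with
  | BasicSum c => basic_sum c
  | CfAdd e1 e2 => cf_value e1 + cf_value e2
  | CfSub e1 e2 => cf_value e1 - cf_value e2
  | CfDiv e1 e2 => cf_value e1 / cf_value e2
  | CfRoot e1 => cf_value e1 `^ (alpha%:R^-1)
  | CfLog e1 => ln (cf_value e1)
  end.

(* F, /, powR and ln are total functions; this says that each of them is only
   applied inside its mathematical domain when evaluating the expression. *)
Fixpoint cf_defined (e : cf_expr alpha N) : Prop :=
  match e with
  | BasicSum _ =>
      (forall i, Theta (eta i)) /\
      (forall a : {ffun 'I_N -> 'I_alpha.+1}, (\sum_i a i)%N = alpha ->
         Theta (\sum_i (a i)%:R *: eta i))
  | CfAdd e1 e2 | CfSub e1 e2 => cf_defined e1 /\ cf_defined e2
  | CfDiv e1 e2 => [/\ cf_defined e1, cf_defined e2 & cf_value e2 != 0]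
  | CfRoot e1 => cf_defined e1 /\ 0 <= cf_value e1
  | CfLog e1 => cf_defined e1 /\ 0 < cf_value e1
  end.

(* In particular q is finite. *)
Definition given_by (q : \bar R) (e : cf_expr alpha N) : Prop :=
  cf_defined e /\ q = (cf_value e)%:E.

End closed_form.

(* Main.v *)
(* Concatenate the two mixtures into sum_i v_i p_(eta_i).  For signs s, the
   power (sum_i s_i v_i p_(eta_i))^alpha expands by the multinomial theorem, and
   prod_i p_(eta_i)^(a_i) = exp(<t, sum_i a_i eta_i> - sum_i a_i F(eta_i)) has
   integral exp(F(sum_i a_i eta_i) - sum_i a_i F(eta_i)), so the integral of the
   power is a basic sum.  All these integrals are finite: for |a| = alpha,
   exp(sum_i a_i y_i) <= sum_i exp(alpha y_i), and alpha eta_i lies in the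
   cone.  Finally |f|^alpha = f^alpha when f >= 0 or alpha is even; the
   signs (1,0), (0,1), (1,1) and (1,-1) on the two blocks give m, m', m + m'
   and m - m'. *)
Require Import Defs.
From HB Require Import structures.
From mathcomp Require Import all_boot all_order all_algebra.
From mathcomp Require Import all_classical all_reals all_analysis.
From mathcomp Require Import measurable_realfun.

Set Implicit Arguments.
Unset Strict Implicit.
Unset Printing Implicit Defensive.

Import Order.TTheory GRing.Theory Num.Theory.

Local Open Scope classical_set_scope.
Local Open Scope ring_scope.

(** * Multinomial expansion with signs *)

Section multiindex.
Variables (alpha N : nat).

(** A map [g] selects one summand from each of the [alpha] factors of a power. No count exceeds
    [alpha], so [inord] loses nothing. *)
Definition multiplicity (g : {ffun 'I_alpha -> 'I_N}) :
    {ffun 'I_N -> 'I_alpha.+1} :=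
  [ffun i => inord #|[pred j | g j == i]|].

Lemma multiplicityE g i : multiplicity g i = #|[pred j | g j == i]| :> nat.
Proof. by rewrite ffunE inordK // ltnS -[leqRHS]card_ord max_card. Qed.

Lemma weight_multiplicity g : (\sum_i multiplicity g i)%N = alpha.
Proof.
under eq_bigr do rewrite multiplicityE.
rewrite -[RHS]card_ord -[RHS]sum1_card (partition_big g predT) //=.
by apply: eq_bigr => i _; rewrite -sum1_card.
Qed.

Lemma prod_multiplicity (A : comPzRingType) (y : 'I_N -> A)
    (g : {ffun 'I_alpha -> 'I_N}) :
  \prod_j y (g j) = \prod_i y i ^+ multiplicity g i.
Proof.
rewrite (partition_big g predT) //=; apply: eq_bigr => i _.
under eq_bigr => j /eqP -> do [].
by rewrite prodr_const multiplicityE.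
Qed.

(* The cardinal is the multinomial coefficient alpha! / prod_i a_i!. *)
Definition signed_multinomial (s : 'I_N -> int)
    (a : {ffun 'I_N -> 'I_alpha.+1}) : int :=
  #|[pred g | multiplicity g == a]|%:Z * \prod_i s i ^+ a i.

(** Distributing the product of [alpha] equal sums gives a sum over all maps [g], which is then
    grouped by [multiplicity g]. *)
Lemma expr_sum_multiindex (A : comPzRingType) (s : 'I_N -> int)
    (y : 'I_N -> A) :
  (\sum_i (s i)%:~R * y i) ^+ alpha =
  \sum_(a : {ffun 'I_N -> 'I_alpha.+1} | (\sum_i a i)%N == alpha)
    (signed_multinomial s a)%:~R * \prod_i y i ^+ a i.
Proof.
rewrite -[in LHS](card_ord alpha) -prodr_const bigA_distr_bigA.
rewrite (partition_big multiplicity (fun a : {ffun 'I_N -> 'I_alpha.+1} =>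
  (\sum_i a i)%N == alpha)) /=; last first.
  by move=> g _; rewrite weight_multiplicity.
apply: eq_bigr => a _.
transitivity (\sum_(g | multiplicity g == a)
    (\prod_i (s i)%:~R ^+ a i) * \prod_i y i ^+ a i : A).
  apply: eq_bigr => g /eqP <-.
  rewrite big_split /= prod_multiplicity.
  by rewrite (prod_multiplicity (fun i => (s i)%:~R)).
rewrite sumr_const -mulr_natl mulrA /signed_multinomial intrM rmorph_prod.
by do 2 congr (_ * _); apply: eq_bigr => i _; rewrite rmorphXn.
Qed.

End multiindex.

(** * Partition functions and the natural space *)

Section exponential_family.
Context {d : measure_display} {X : measurableType d} {R : realType}.
Variables (mu : {measure set X -> \bar R}) (D : nat) (t : X -> D.-tuple R).
Hypotheses (mu0 : mu [set: X] != 0%E) (mt : measurable_fun [set: X] t).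
Hypothesis cone : conic_expfam mu t.

(** If the integral were zero, [f] would vanish almost everywhere; as [f] vanishes nowhere, the
    whole space would be null, against [mu0]. *)
Lemma integral_gt0 (f : X -> R) : measurable_fun [set: X] f ->
  (forall x, 0 < f x) -> (0 < \int[mu]_x (f x)%:E)%E.
Proof.
move=> mf f0; rewrite lt0e integral_ge0 ?andbT; last first.
  by move=> x _; rewrite lee_fin ltW.
apply: contra mu0 => /eqP int0.
have : (\int[mu]_x `|(f x)%:E| = 0)%E.
  by rewrite -int0; apply: eq_integral => x _; rewrite gee0_abs// lee_fin ltW.
have /measurable_EFinP mEf := mf.
move/(ae_eq_integral_abs mu measurableT mEf) => [A [mA A0 sA]].
suff -> : [set: X] = A by rewrite A0.
apply/seteqP; split => // x _; apply: sA => /= /(_ I) [] /eqP.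
by rewrite gt_eqF.
Qed.

Lemma stat_dotZ c theta x : stat_dot t (c *: theta) x = c * stat_dot t theta x.
Proof. by rewrite mulr_sumr; apply: eq_bigr => j _; rewrite mxE mulrCA. Qed.

Lemma stat_dot_sum I (r : seq I) (c : I -> R) (eta : I -> 'rV[R]_D) x :
  stat_dot t (\sum_(i <- r) c i *: eta i) x =
  \sum_(i <- r) c i * stat_dot t (eta i) x.
Proof.
under [RHS]eq_bigr do rewrite mulr_sumr.
rewrite exchange_big /=; apply: eq_bigr => j _.
rewrite summxE mulr_sumr; apply: eq_bigr => i _.
by rewrite mxE mulrCA.
Qed.

Lemma measurable_stat_dot theta : measurable_fun [set: X] (stat_dot t theta).
Proof.
apply: measurable_sum => i; apply: measurable_funM => //.
exact: measurableT_comp (measurable_tnth i) mt.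
Qed.

Lemma measurable_expR_stat_dot theta :
  measurable_fun [set: X] (fun x => expR (stat_dot t theta x)).
Proof.
exact: measurableT_comp (@measurable_expR R) (measurable_stat_dot theta).
Qed.

(** The conventions of [fine] and [ln] are harmless here: the integral is positive because [mu] is
    nonzero, and finite on the natural space. *)
Lemma expR_log_partition theta : natural_space mu t theta ->
  (expR (log_partition mu t theta))%:E = partition_function mu t theta.
Proof.
move=> theta_nat.
have p0 : (0 < partition_function mu t theta)%E.
  apply: integral_gt0 => [|x]; last exact: expR_gt0.
  exact: measurable_expR_stat_dot.
have fin : partition_function mu t theta \is a fin_num.
  by rewrite ge0_fin_numE ?ltW.
by rewrite /log_partition lnK ?fineK// posrE -lte_fin fineK.
Qed.

Lemma natural_space_comb (N alpha : nat) (a : 'I_N -> nat)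
    (eta : 'I_N -> 'rV[R]_D) : (0 < alpha)%N -> (\sum_i a i)%N = alpha ->
  (forall i, natural_space mu t (eta i)) ->
  natural_space mu t (\sum_i (a i)%:R *: eta i).
Proof.
move=> alpha0 aE eta_nat.
have /= alpha_nat i : natural_space mu t (alpha%:R *: eta i).
  by apply: cone => //; rewrite ltr0n.
have dom x : expR (stat_dot t (\sum_i (a i)%:R *: eta i) x) <=
    \sum_i expR (stat_dot t (alpha%:R *: eta i) x).
  (* A positive weight forces an index to exist, so a maximum over the indices makes sense. *)
  have N0 : (0 < N)%N.
    case: N a eta aE {eta_nat alpha_nat} => // a eta.
    by rewrite big_ord0 => aE; rewrite -aE in alpha0.
  pose i0 := Ordinal N0.
  pose S i := stat_dot t (eta i) x.
  (* Pointwise in [x], a combination of total weight [alpha] is at most [alpha] times the largest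
     [S i]; the remaining exponentials are nonnegative. *)
  have [i _ imax] := @arg_maxP _ R 'I_N i0 xpredT S isT.
  rewrite [leRHS](bigD1 i) //= -[leLHS]addr0 lerD ?sumr_ge0 //.
  rewrite ler_expR stat_dot_sum stat_dotZ -[in leRHS]aE natr_sum mulr_suml.
  by apply: ler_sum => j _; rewrite ler_wpM2l ?ler0n //; exact: imax.
apply: (@le_lt_trans _ _
    (\int[mu]_x (\sum_i (expR (stat_dot t (alpha%:R *: eta i) x))%:E))%E).
  apply: ge0_le_integral => // [||x _].
  - exact: measurableT_comp (measurable_expR_stat_dot _).
  - apply: emeasurable_sum => i.
    exact: measurableT_comp (measurable_expR_stat_dot _).
  - by rewrite sumEFin lee_fin.
rewrite ge0_integral_sum //.
  by apply: lte_sum_pinfty => i _; exact: alpha_nat.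
by move=> i; exact: measurableT_comp (measurable_expR_stat_dot _).
Qed.

(** * Integrals of powers of signed mixtures *)

Section mixture_powers.
Variables (alpha N : nat) (v : 'I_N -> R) (eta : 'I_N -> 'rV[R]_D).
Hypotheses (alpha0 : (0 < alpha)%N).
Hypothesis eta_nat : forall i, natural_space mu t (eta i).

(** The signs are integers so that they can be absorbed into the coefficients of a basic sum, which
    are independent of [R]. *)
Definition signed_mixture (s : 'I_N -> int) (x : X) : R :=
  \sum_i (s i)%:~R * (v i * expfam_density mu t (eta i) x).

Definition signed_basic_sum (s : 'I_N -> int) : R :=
  basic_sum (log_partition mu t) v eta (signed_multinomial (alpha := alpha) s).

Lemma measurable_expfam_density theta :
  measurable_fun [set: X] (expfam_density mu t theta).
Proof.
apply: (measurableT_comp (@measurable_expR R)).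
by apply: measurable_funB => //; exact: measurable_stat_dot.
Qed.

Lemma measurable_signed_mixture s : measurable_fun [set: X] (signed_mixture s).
Proof.
apply: measurable_sum => i; apply: measurable_funM => //.
by apply: measurable_funM => //; exact: measurable_expfam_density.
Qed.

(** Separates the normalizers, constant in [x], from an exponential whose integral is a partition
    function. *)
Lemma prod_expfam_density (a : 'I_N -> nat) x :
  \prod_i expfam_density mu t (eta i) x ^+ a i =
  expR (- \sum_i (a i)%:R * log_partition mu t (eta i)) *
  expR (stat_dot t (\sum_i (a i)%:R *: eta i) x).
Proof.
under eq_bigr do rewrite -expRM_natl mulrBr.
by rewrite -expRD -expR_sum sumrB addrC stat_dot_sum.
Qed.

Lemma integral_signed_mixture_expr s :
  (\int[mu]_x (signed_mixture s x ^+ alpha)%:E = (signed_basic_sum s)%:E)%E.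
Proof.
(* Each term of the expansion is [C a * E a x], with only [E a] depending on the point. *)
pose C (a : {ffun 'I_N -> 'I_alpha.+1}) : R :=
  (signed_multinomial s a)%:~R * (\prod_i v i ^+ a i) *
  expR (- \sum_i (a i)%:R * log_partition mu t (eta i)).
pose E (a : {ffun 'I_N -> 'I_alpha.+1}) x : R :=
  expR (stat_dot t (\sum_i (a i)%:R *: eta i) x).
have E_int (a : {ffun 'I_N -> 'I_alpha.+1}) : (\sum_i a i)%N == alpha ->
    (\int[mu]_x (E a x)%:E =
     (expR (log_partition mu t (\sum_i (a i)%:R *: eta i)))%:E)%E.
  move=> /eqP aE; rewrite expR_log_partition //.
  exact: natural_space_comb aE eta_nat.
(* The coefficients may be negative, so integrating term by term requires integrability. *)
have E_integrable (a : {ffun 'I_N -> 'I_alpha.+1}) :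
    (\sum_i a i)%N == alpha -> mu.-integrable [set: X] (EFin \o E a).
  move=> aE; apply/integrableP; split.
    exact: measurableT_comp (measurable_expR_stat_dot _).
  under eq_integral do rewrite gee0_abs ?lee_fin ?expR_ge0 //.
  by rewrite E_int // ltry.
have expand x : signed_mixture s x ^+ alpha =
    \sum_(a : {ffun 'I_N -> 'I_alpha.+1} | (\sum_i a i)%N == alpha) C a * E a x.
  rewrite expr_sum_multiindex; apply: eq_bigr => a _.
  under eq_bigr do rewrite exprMn.
  by rewrite big_split /= prod_expfam_density /C !mulrA.
(* [integral_sum] needs integrability at every index, also outside the filter. *)
pose term (a : {ffun 'I_N -> 'I_alpha.+1}) x : \bar R :=
  if (\sum_i a i)%N == alpha then ((C a)%:E * (E a x)%:E)%E else 0%E.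
transitivity (\int[mu]_x \sum_(a : {ffun 'I_N -> 'I_alpha.+1}) term a x)%E.
  apply: eq_integral => x _; rewrite expand -sumEFin [LHS]big_mkcond /=.
  by apply: eq_bigr => a _; rewrite /term EFinM.
rewrite integral_sum // => [|a]; last first.
  rewrite /term; case: eqP => [/eqP aE|_]; last exact: integrable0.
  by apply: integrableZl => //; exact: E_integrable.
rewrite /signed_basic_sum /basic_sum -sumEFin [RHS]big_mkcond /=.
apply: eq_bigr => a _; rewrite /term.
case: eqP => [/eqP aE|_]; last exact: integral0.
rewrite integralZl ?E_int //; last exact: E_integrable.
by rewrite -EFinM /C [in RHS]addrC expRD mulrA.
Qed.

(** The sign is read off the integral, since the terms of the sum may have either sign. *)
Lemma signed_basic_sum_gt0 s :
  (forall x, 0 < signed_mixture s x) -> 0 < signed_basic_sum s.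
Proof.
move=> f0; rewrite -lte_fin -integral_signed_mixture_expr.
apply: integral_gt0 => [|x]; last by rewrite exprn_gt0.
by apply: measurable_funX; exact: measurable_signed_mixture.
Qed.

Lemma signed_basic_sum_ge0 s : (forall x, 0 <= signed_mixture s x ^+ alpha) ->
  0 <= signed_basic_sum s.
Proof.
move=> f0; rewrite -lee_fin -integral_signed_mixture_expr.
by apply: integral_ge0 => x _; rewrite lee_fin.
Qed.

Lemma Lalpha_norm_signed_mixture s :
  (forall x, 0 <= signed_mixture s x) \/ ~~ odd alpha ->
  Lalpha_norm mu alpha%:R (signed_mixture s) =
  (signed_basic_sum s `^ alpha%:R^-1)%:E.
Proof.
move=> fa; rewrite /Lalpha_norm unlock -poweR_EFin; congr (_ `^ _)%E.
rewrite -integral_signed_mixture_expr; apply: eq_integral => x _ /=.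
(* The real power becomes an ordinary one; the absolute value then drops by pointwise sign or by
   parity. *)
rewrite powR_mulrn //; case: fa => [f0|ev]; first by rewrite ger0_norm.
by rewrite -normrX ger0_norm // exprn_even_ge0.
Qed.

End mixture_powers.
End exponential_family.

(** * Two concatenated mixtures and their norms *)

Section cat.
Variables (k k' : nat).

Lemma ord_catl T (f : 'I_k -> T) (g : 'I_k' -> T) i :
  ord_cat f g (lshift k' i) = f i.
Proof. by rewrite /ord_cat (unsplitK (inl i)). Qed.

Lemma ord_catr T (f : 'I_k -> T) (g : 'I_k' -> T) i :
  ord_cat f g (rshift k i) = g i.
Proof. by rewrite /ord_cat (unsplitK (inr i)). Qed.

Lemma ord_catP T (P : T -> Prop) (f : 'I_k -> T) (g : 'I_k' -> T) :
  (forall i, P (f i)) -> (forall j, P (g j)) -> forall i, P (ord_cat f g i).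
Proof. by move=> Pf Pg i; rewrite /ord_cat; case: fintype.split. Qed.

Definition block_sign (b b' : int) : 'I_(k + k') -> int :=
  ord_cat (fun=> b) (fun=> b').

Lemma signed_mixture_cat d (X : measurableType d) (R : realType)
    (mu : {measure set X -> \bar R}) D (t : X -> D.-tuple R)
    (w : 'I_k -> R) (w' : 'I_k' -> R) (theta : 'I_k -> 'rV[R]_D)
    (theta' : 'I_k' -> 'rV[R]_D) (b b' : int) x :
  signed_mixture mu t (ord_cat w w') (ord_cat theta theta')
    (block_sign b b') x =
  b%:~R * mixture mu t w theta x + b'%:~R * mixture mu t w' theta' x.
Proof.
rewrite /signed_mixture /mixture big_split_ord /= !mulr_sumr.
apply: f_equal2; apply: eq_bigr => i _; first by rewrite /block_sign !ord_catl.
by rewrite /block_sign !ord_catr.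
Qed.

(** Expression for the norm of [b m + b' m']. It involves no scalars, measure or parameters, so it
    can be chosen before them. *)
Definition cf_norm alpha (b b' : int) : cf_expr alpha (k + k') :=
  CfRoot (BasicSum (signed_multinomial (block_sign b b'))).

End cat.

(** Densities are positive, so a zero of the mixture would force all weights to vanish, though they
    sum to one. *)
Lemma mixture_gt0 d (X : measurableType d) (R : realType)
    (mu : {measure set X -> \bar R}) D (t : X -> D.-tuple R) k
    (w : 'I_k -> R) (theta : 'I_k -> 'rV[R]_D) x :
  (forall i, 0 <= w i) -> \sum_i w i = 1 -> 0 < mixture mu t w theta x.
Proof.
move=> w0 w1; have p0 i : 0 <= w i * expfam_density mu t (theta i) x.
  by rewrite mulr_ge0 ?expR_ge0.
rewrite lt0r sumr_ge0 // andbT; apply/eqP => /psumr_eq0P m0.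
have /eqP := w1; rewrite big1 ?(eq_sym 0) ?oner_eq0 // => i _.
have /eqP := m0 (fun i _ => p0 i) i isT.
by rewrite mulf_eq0 (gt_eqF (expR_gt0 _)) orbF => /eqP.
Qed.

(** The minus sign is absorbed by inverting the quotient, as [cf_expr] has no negation. *)
Lemma oppe_lne_div (R : realType) (a b c : R) : 0 < a -> 0 < b -> 0 < c ->
  (- lne (c%:E / (a%:E + b%:E)) = (ln ((a + b) / c))%:E)%E.
Proof.
move=> a0 b0 c0; have ab0 := addr_gt0 a0 b0.
rewrite -EFinD inver gt_eqF // -EFinM lne_EFin ?divr_gt0 //.
by rewrite -EFinN -lnV ?posrE ?divr_gt0 // invf_div.
Qed.

(** * Closed forms of the three distances *)

Theorem theorem7 (alpha k k' : nat)
    (halpha : (2 <= alpha)%N) (hk : (1 <= k)%N) (hk' : (1 <= k')%N) :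
  exists eD eL eM : cf_expr alpha (k + k'),
  forall (R : realType) (d : measure_display) (X : measurableType d)
    (mu : {measure set X -> \bar R}) (D : nat) (t : X -> D.-tuple R)
    (theta : 'I_k -> 'rV[R]_D) (theta' : 'I_k' -> 'rV[R]_D)
    (w : 'I_k -> R) (w' : 'I_k' -> R),
  mu [set: X] != 0%E ->
  measurable_fun [set: X] t ->
  conic_expfam mu t ->
  (forall i, natural_space mu t (theta i)) ->
  (forall j, natural_space mu t (theta' j)) ->
  (forall i, 0 <= w i) ->
  (forall j, 0 <= w' j) ->
  \sum_(i < k) w i = 1 ->
  \sum_(j < k') w' j = 1 ->
  let m := mixture mu t w theta in
  let m' := mixture mu t w' theta' in
  let closed_form := given_by (natural_space mu t) (log_partition mu t)
                       (ord_cat w w') (ord_cat theta theta') in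
  (closed_form (minkowski_diff_dist mu alpha%:R m m') eD
   /\ closed_form (minkowski_logratio_dist mu alpha%:R m m') eL)
  /\ (~~ odd alpha -> closed_form (minkowski_dist mu alpha%:R m m') eM).
Proof.
have alpha0 : (0 < alpha)%N by exact: ltnW.
pose np := cf_norm k k' alpha 1 0.
pose nq := cf_norm k k' alpha 0 1.
pose npq := cf_norm k k' alpha 1 1.
exists (CfSub (CfAdd np nq) npq), (CfLog (CfDiv (CfAdd np nq) npq)),
  (cf_norm k k' alpha 1 (-1)).
move=> R d X mu D t theta theta' w w' mu0 mt cone theta_nat theta'_nat.
move=> w0 w'0 w1 w'1 m m' /=.
have eta_nat : forall i, natural_space mu t (ord_cat theta theta' i).
  exact: ord_catP.
have m0 x : 0 < m x by exact: mixture_gt0.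
have m'0 x : 0 < m' x by exact: mixture_gt0.
pose f b b' := signed_mixture mu t (ord_cat w w') (ord_cat theta theta')
  (block_sign b b').
pose value := cf_value (alpha := alpha) (log_partition mu t)
  (ord_cat w w') (ord_cat theta theta').
have normE (b b' : int) (g : X -> R) : f b b' = g ->
    (forall x, 0 <= g x) \/ ~~ odd alpha ->
    given_by (natural_space mu t) (log_partition mu t)
      (ord_cat w w') (ord_cat theta theta')
      (Lalpha_norm mu alpha%:R g) (cf_norm k k' alpha b b').
  move=> <- g0; split; last exact: Lalpha_norm_signed_mixture.
  (* The basic sum evaluates [F] only inside the natural space; the root also needs a nonnegative
     argument. *)
  split; first split => // a aE; first exact: natural_space_comb aE eta_nat.
  apply: (signed_basic_sum_ge0 mu0 mt cone) => // x.
  by case: g0 => [g0|ev]; [exact: exprn_ge0 (g0 x)|exact: exprn_even_ge0].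
(* Strict positivity is what the denominator and the logarithm in the log-ratio require. *)
have norm_gt0 b b' (g : X -> R) : f b b' = g -> (forall x, 0 < g x) ->
    0 < value (cf_norm k k' alpha b b').
  move=> <- g0; by apply: powR_gt0; apply: (signed_basic_sum_gt0 mu0 mt cone).
have fp : f 1 0 = m.
  by apply/funext => x; rewrite /f signed_mixture_cat mul1r mul0r addr0.
have fq : f 0 1 = m'.
  by apply/funext => x; rewrite /f signed_mixture_cat mul1r mul0r add0r.
have fpq : f 1 1 = m \+ m'.
  by apply/funext => x; rewrite /f signed_mixture_cat !mul1r.
have fm : f 1 (-1) = m \- m'.
  by apply/funext => x; rewrite /f signed_mixture_cat mul1r mulN1r.
have mm'0 x : 0 < (m \+ m') x by rewrite addr_gt0.
have [dp Np] := normE _ _ _ fp (or_introl (fun x => ltW (m0 x))).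
have [dq Nq] := normE _ _ _ fq (or_introl (fun x => ltW (m'0 x))).
have [dpq Npq] := normE _ _ _ fpq (or_introl (fun x => ltW (mm'0 x))).
have vp := norm_gt0 _ _ _ fp m0.
have vq := norm_gt0 _ _ _ fq m'0.
have vpq := norm_gt0 _ _ _ fpq mm'0.
(* The difference [m \- m'] may change sign, so here evenness of [alpha] is the alternative used. *)
split; last by move=> ev; apply: normE fm _; right.
rewrite /minkowski_diff_dist /minkowski_logratio_dist Np Nq Npq.
split; split => //.
  split; last exact: divr_gt0 (addr_gt0 vp vq) vpq.
  by split => //; exact: lt0r_neq0.
exact: oppe_lne_div vp vq vpq.
Qed.
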